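(* Let $B$ be a non-abelian group and let $H$ be a finitely generated infinite group. Then the unrestricted wreath product $B\wr H$ contains a condensed subgroup.
   Context: For groups $B,H$, $B^H$ denotes the group of all functions $H\to B$ under pointwise multiplication, and the unrestricted wreath product $B\wr H$ is the semidirect product $B^H\rtimes H$ where $H$ acts by $(hfh^{-1})(x)=f(h^{-1}x)$ for $h,x\in H$, $f\in B^H$. Space of marked groups: for $n\in\mathbb N$, $\mathcal G_n$ is the set of pairs $(G,A)$, $G$ a group and $A=(a_1,\dots,a_n)$ an ordered generating tuple, modulo $(G,(a_i))\approx(H,(b_i))$ iff $a_i\mapsto b_i$ extends to an isomorphism $G\to H$. Write $(G,A)\approx_r(H,B)$ if there is an isomorphism of labeled directed graphs between the balls of radius $r$ about the identity in the Cayley graphs of $(G,A)$ and $(H,B)$ sending edges labeled $a_i$ to edges labeled $b_i$. The topology on $\mathcal G_n$ has basis the sets $\{(H,B)\in\mathcal G_n:(H,B)\approx_r(G,A)\}$, $r\in\mathbb N$. Identifying $(G,(a_1,\dots,a_n))$ with $(G,(a_1,\dots,a_n,1))$ embeds $\mathcal G_n\subseteq\mathcal G_{n+1}$, and $\mathcal G=\bigcup_n\mathcal G_n$ with the union topology is the space of finitely generated marked groups. For a finitely generated group $G$, $[G]=\{(H,B)\in\mathcal G: H\cong G\}$. A finitely generated group $G$ is condensed if $[G]$ has no isolated points in $\mathcal G$. *)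

(* Defs.v *)
From Stdlib Require Import List Arith FunctionalExtensionality ProofIrrelevance.
Import ListNotations.

Record group := Group {
  gcar :> Type;
  gmul : gcar -> gcar -> gcar;
  gone : gcar;
  ginv : gcar -> gcar;
  gmulA : forall x y z, gmul x (gmul y z) = gmul (gmul x y) z;
  gmul1l : forall x, gmul gone x = x;
  gmul1r : forall x, gmul x gone = x;
  gmulVl : forall x, gmul (ginv x) x = gone;
  gmulVr : forall x, gmul x (ginv x) = gone }.

Arguments gmul {g}.
Arguments gone {g}.
Arguments ginv {g}.

Lemma ginv_mul (G : group) (x y : G) : ginv (gmul x y) = gmul (ginv y) (ginv x).
Proof.
  assert (E : gmul (gmul x y) (gmul (ginv y) (ginv x)) = gone).
  { rewrite <- gmulA, (gmulA _ y), gmulVr, gmul1l, gmulVr. reflexivity. }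
  rewrite <- (gmul1r _ (ginv (gmul x y))), <- E, gmulA, gmulVl, gmul1l.
  reflexivity.
Qed.

Lemma ginv_one (G : group) : ginv (@gone G) = gone.
Proof. rewrite <- (gmul1l _ (ginv gone)), gmulVr. reflexivity. Qed.

Lemma ginv_inv (G : group) (x : G) : ginv (ginv x) = x.
Proof.
  rewrite <- (gmul1r _ (ginv (ginv x))), <- (gmulVl _ x), gmulA, gmulVl, gmul1l.
  reflexivity.
Qed.

Definition ghom (G H : group) (f : G -> H) : Prop :=
  forall x y, f (gmul x y) = gmul (f x) (f y).
Definition giso_map (G H : group) (f : G -> H) : Prop :=
  ghom G H f /\ exists g : H -> G, (forall x, g (f x) = x) /\ (forall y, f (g y) = y).
Definition giso (G H : group) : Prop := exists f : G -> H, giso_map G H f.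

Definition abelian (G : group) : Prop := forall x y : G, gmul x y = gmul y x.
Definition finite_group (G : group) : Prop := exists l : list G, forall x, In x l.

Fixpoint evalw (G : group) (a : nat -> G) (w : list (nat * bool)) : G :=
  match w with
  | [] => gone
  | (i, b) :: w' => gmul (if b then ginv (a i) else a i) (evalw G a w')
  end.

Definition word_in (n : nat) (w : list (nat * bool)) : Prop :=
  forall x, In x w -> fst x < n.

Definition generates (G : group) (n : nat) (a : nat -> G) : Prop :=
  forall g : G, exists w, word_in n w /\ evalw G a w = g.

Definition fin_gen (G : group) : Prop := exists n (a : nat -> G), generates G n a.

Definition in_ball (G : group) (n : nat) (a : nat -> G) (r : nat) (g : G) : Prop :=
  exists w, word_in n w /\ length w <= r /\ evalw G a w = g.

(* A generating n-tuple (a_0,...,a_{n-1}) is encoded as a : nat -> G with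
   a i = 1 for i >= n; the embedding G_n ⊆ G_{n+1} (append 1) is then the
   identity on representatives, and G = ⋃_n G_n. *)
Record mpoint := MPoint { mp_G : group; mp_a : nat -> mp_G }.

Definition in_Gn (n : nat) (p : mpoint) : Prop :=
  (forall i, n <= i -> mp_a p i = gone) /\ generates (mp_G p) n (mp_a p).

Definition in_G (p : mpoint) : Prop := exists n, in_Gn n p.

Definition mp_equiv (p q : mpoint) : Prop :=
  exists f : mp_G p -> mp_G q, giso_map _ _ f /\ forall i, f (mp_a p i) = mp_a q i.

(* (G,A) ≈_r (H,B) in G_n: rooted isomorphism of the labelled directed
   Cayley-graph balls of radius r (edges x -> x a_i labelled i, i < n) *)
Definition ball_equiv (n r : nat) (p q : mpoint) : Prop :=
  exists phi : mp_G p -> mp_G q,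
    phi gone = gone /\
    (forall x, in_ball _ n (mp_a p) r x -> in_ball _ n (mp_a q) r (phi x)) /\
    (forall x y, in_ball _ n (mp_a p) r x -> in_ball _ n (mp_a p) r y ->
       phi x = phi y -> x = y) /\
    (forall y, in_ball _ n (mp_a q) r y ->
       exists x, in_ball _ n (mp_a p) r x /\ phi x = y) /\
    (forall x y i, in_ball _ n (mp_a p) r x -> in_ball _ n (mp_a p) r y -> i < n ->
       (y = gmul x (mp_a p i) <-> phi y = gmul (phi x) (mp_a q i))).

(* Open subsets of G (subsets of the quotient = ≈-invariant predicates), for
   the union topology: U ∩ G_n is open in G_n for each n, i.e. every point of
   U ∩ G_n has a basic neighbourhood {q ∈ G_n | q ≈_r p} inside U. *)
Definition mopen (U : mpoint -> Prop) : Prop :=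
  (forall p q, mp_equiv p q -> U p -> U q) /\
  (forall n p, in_Gn n p -> U p ->
     exists r, forall q, in_Gn n q -> ball_equiv n r q p -> U q).

Definition isolated_in_class (G0 : group) (p : mpoint) : Prop :=
  exists U, mopen U /\ U p /\
    forall q, in_G q -> giso (mp_G q) G0 -> U q -> mp_equiv q p.

Definition condensed (G0 : group) : Prop :=
  fin_gen G0 /\
  forall p, in_G p -> giso (mp_G p) G0 -> ~ isolated_in_class G0 p.

Definition is_subgroup (G : group) (P : G -> Prop) : Prop :=
  P gone /\ (forall x y, P x -> P y -> P (gmul x y)) /\ (forall x, P x -> P (ginv x)).

Section Sub.
Variables (G : group) (P : G -> Prop) (hP : is_subgroup G P).
Definition sub_mul (x y : {g : G | P g}) : {g : G | P g} :=
  exist _ (gmul (proj1_sig x) (proj1_sig y))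
    (proj1 (proj2 hP) _ _ (proj2_sig x) (proj2_sig y)).
Definition sub_one : {g : G | P g} := exist _ gone (proj1 hP).
Definition sub_inv (x : {g : G | P g}) : {g : G | P g} :=
  exist _ (ginv (proj1_sig x)) (proj2 (proj2 hP) _ (proj2_sig x)).

Lemma sub_eq (x y : {g : G | P g}) : proj1_sig x = proj1_sig y -> x = y.
Proof.
  destruct x as [x px], y as [y py]; simpl; intros ->.
  f_equal; apply proof_irrelevance.
Qed.

Definition subgroup : group.
Proof.
  refine (Group {g : G | P g} sub_mul sub_one sub_inv _ _ _ _ _);
  intros; apply sub_eq; simpl.
  - apply gmulA. - apply gmul1l. - apply gmul1r. - apply gmulVl. - apply gmulVr.
Defined.
End Sub.

(* (f,h)(f',h') = (x |-> f x * f' (h^-1 x), h h'), i.e. (h f h^-1)(x) = f(h^-1 x) *)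
Section Wreath.
Variables (B H : group).
Definition wr_car : Type := ((H -> B) * H)%type.
Definition wr_mul (u v : wr_car) : wr_car :=
  (fun x => gmul (fst u x) (fst v (gmul (ginv (snd u)) x)), gmul (snd u) (snd v)).
Definition wr_one : wr_car := (fun _ => gone, gone).
Definition wr_inv (u : wr_car) : wr_car :=
  (fun x => ginv (fst u (gmul (snd u) x)), ginv (snd u)).

Definition wreath : group.
Proof.
  refine (Group wr_car wr_mul wr_one wr_inv _ _ _ _ _).
  - intros [f h] [f' h'] [f'' h'']; unfold wr_mul; simpl; f_equal.
    + apply functional_extensionality; intro x.
      rewrite ginv_mul, gmulA, <- (gmulA _ (ginv h') (ginv h) x). reflexivity.
    + apply gmulA.
  - intros [f h]; unfold wr_mul; simpl; f_equal.
    + apply functional_extensionality; intro x. rewrite ginv_one, !gmul1l. reflexivity.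
    + apply gmul1l.
  - intros [f h]; unfold wr_mul; simpl; f_equal.
    + apply functional_extensionality; intro x. apply gmul1r.
    + apply gmul1r.
  - intros [f h]; unfold wr_mul, wr_one; simpl; f_equal.
    + apply functional_extensionality; intro x.
      rewrite ginv_inv. apply gmulVl.
    + apply gmulVl.
  - intros [f h]; unfold wr_mul, wr_one; simpl; f_equal.
    + apply functional_extensionality; intro x.
      rewrite gmulA, gmulVr, gmul1l. apply gmulVr.
    + apply gmulVr.
Defined.
End Wreath.

(* Main.v *)
(* Fix non-commuting x, y in B and a subset S of H with indicator phi.  Let f be x on S and 1
   elsewhere, let g be y at 1 and 1 elsewhere, and let G be generated by H, f and g.
   Conjugating f by an element of H yields another marking of G, in which S is replaced by a
   translate.  A word is trivial iff it is trivial at every point of H.  Away from a finite set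
   its value only involves powers of x; if S has points isolated at every scale, triviality
   there says that certain powers of x vanish, independently of S.  On the finite set the
   value depends only on a finite part of S.  Hence if S is moreover recurrent, i.e. agrees on
   any given finite set with some nontrivial translate of itself, the marking is a limit of
   markings of G, and these differ from it because [f^k, g] = 1 iff k^-1 is not in S. *)

From Stdlib Require Import List Arith Lia ZArith Classical ClassicalEpsilon FunctionalExtensionality Setoid.
Require Import Defs.
Import ListNotations.

(** * Cancellation in groups and elementary facts on homomorphisms *)

Lemma gmulKV (G : group) (x y : G) : gmul (ginv x) (gmul x y) = y.
Proof. now rewrite gmulA, gmulVl, gmul1l. Qed.

Lemma gmulVK (G : group) (x y : G) : gmul x (gmul (ginv x) y) = y.
Proof. now rewrite gmulA, gmulVr, gmul1l. Qed.

Ltac gsimpl := repeat rewrite ?ginv_mul, ?ginv_inv, ?ginv_one, <- ?gmulA, ?gmul1l,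
  ?gmul1r, ?gmulVl, ?gmulVr, ?gmulKV, ?gmulVK.

Lemma gmul_cancel_l (G : group) (z x y : G) : gmul z x = gmul z y -> x = y.
Proof. intro E. now rewrite <- (gmulKV G z x), E, gmulKV. Qed.

Lemma gmul_cancel_r (G : group) (z x y : G) : gmul x z = gmul y z -> x = y.
Proof.
  intro E. rewrite <- (gmul1r _ x), <- (gmul1r _ y), <- (gmulVr _ z).
  now rewrite !gmulA, E.
Qed.

Lemma gmulV_eq1 (G : group) (x y : G) : gmul x (ginv y) = gone <-> x = y.
Proof.
  split; [intro E | intros ->; apply gmulVr].
  apply (gmul_cancel_r _ (ginv y)). now rewrite gmulVr.
Qed.

Lemma ginv_eq (G : group) (x y : G) : gmul x y = gone -> y = ginv x.
Proof. intro E. apply (gmul_cancel_l _ x). now rewrite gmulVr. Qed.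

Lemma ghom_one (G K : group) (f : G -> K) : ghom G K f -> f gone = gone.
Proof.
  intro hf. apply (gmul_cancel_l _ (f gone)).
  now rewrite <- hf, gmul1l, gmul1r.
Qed.

Lemma ghom_inv (G K : group) (f : G -> K) (x : G) :
  ghom G K f -> f (ginv x) = ginv (f x).
Proof.
  intro hf. apply ginv_eq. rewrite <- hf, gmulVr. now apply ghom_one.
Qed.

Lemma ghom_eq_one (G K : group) (f : G -> K) (finv : K -> G) (x : G) :
  ghom G K f -> (forall z, finv (f z) = z) -> f x = gone <-> x = gone.
Proof.
  intros hf fK. split; [intro E | intros ->; now apply ghom_one].
  now rewrite <- (fK x), E, <- (ghom_one _ _ f hf), fK.
Qed.

(** * Words *)

Definition winv (w : list (nat * bool)) : list (nat * bool) :=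
  rev (map (fun l => (fst l, negb (snd l))) w).

(** The endomorphism of the free group sending the i-th generator to [v i], on unreduced words. It
    rewrites words in one marking as words in another. *)
Definition wsubst (v : nat -> list (nat * bool)) (w : list (nat * bool)) :=
  flat_map (fun l => if snd l : bool then winv (v (fst l)) else v (fst l)) w.

Lemma word_in_nil n : word_in n [].
Proof. intros l []. Qed.

Lemma word_in_cons n i b w : word_in n ((i, b) :: w) <-> i < n /\ word_in n w.
Proof.
  split.
  - intro h. split; [apply (h (i, b)); now left | intros l hl; apply h; now right].
  - intros [hi h] l [<- | hl]; auto.
Qed.

Lemma word_in_app n w1 w2 : word_in n (w1 ++ w2) <-> word_in n w1 /\ word_in n w2.
Proof.
  split.
  - intro h. split; intros l hl; apply h, in_app_iff; auto.
  - intros [h1 h2] l hl. apply in_app_iff in hl as [hl | hl]; auto.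
Qed.

Lemma word_in_winv n w : word_in n w -> word_in n (winv w).
Proof.
  intros h l hl. apply in_rev, in_map_iff in hl as [l' [<- hl']].
  apply (h l' hl').
Qed.

Lemma word_in_le n m w : n <= m -> word_in n w -> word_in m w.
Proof. intros nm h l hl. specialize (h l hl). lia. Qed.

Lemma length_winv w : length (winv w) = length w.
Proof. unfold winv. now rewrite length_rev, length_map. Qed.

Lemma word_in_wsubst n m v w :
  (forall i, i < n -> word_in m (v i)) -> word_in n w -> word_in m (wsubst v w).
Proof.
  intro hv. induction w as [|[i b] w IH]; intro h; [apply word_in_nil |].
  apply word_in_cons in h as [hi h]. apply word_in_app. split; auto.
  destruct b; [apply word_in_winv |]; now apply hv.
Qed.

Lemma length_wsubst n M v w :
  (forall i, i < n -> length (v i) <= M) -> word_in n w ->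
  length (wsubst v w) <= M * length w.
Proof.
  intro hv. induction w as [|[i b] w IH]; intro h; simpl; [lia |].
  apply word_in_cons in h as [hi h]. specialize (IH h). specialize (hv i hi).
  rewrite length_app. fold (wsubst v w).
  destruct b; rewrite ?length_winv; lia.
Qed.

Lemma evalw_app (G : group) (a : nat -> G) w1 w2 :
  evalw G a (w1 ++ w2) = gmul (evalw G a w1) (evalw G a w2).
Proof.
  induction w1 as [|[i b] w1 IH]; simpl; gsimpl; [easy |]. now rewrite IH.
Qed.

Lemma evalw_winv (G : group) (a : nat -> G) w :
  evalw G a (winv w) = ginv (evalw G a w).
Proof.
  induction w as [|[i b] w IH]; unfold winv; simpl; gsimpl; [easy |].
  rewrite evalw_app. fold (winv w). rewrite IH. destruct b; simpl; now gsimpl.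
Qed.

Lemma evalw_wsubst (G : group) (c : nat -> G) v w :
  evalw G c (wsubst v w) = evalw G (fun i => evalw G c (v i)) w.
Proof.
  induction w as [|[i b] w IH]; simpl; [easy |].
  rewrite evalw_app. fold (wsubst v w). rewrite IH.
  destruct b; now rewrite ?evalw_winv.
Qed.

Lemma evalw_ext (G : group) n (a b : nat -> G) w :
  (forall i, i < n -> a i = b i) -> word_in n w -> evalw G a w = evalw G b w.
Proof.
  intro hab. induction w as [|[i s] w IH]; intro h; simpl; [easy |].
  apply word_in_cons in h as [hi h]. now rewrite IH, hab.
Qed.

Lemma evalw_hom (G K : group) (f : G -> K) (a : nat -> G) w :
  ghom G K f -> f (evalw G a w) = evalw K (fun i => f (a i)) w.
Proof.
  intro hf. induction w as [|[i b] w IH]; simpl; [now apply ghom_one |].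
  rewrite hf, IH. destruct b; now rewrite ?ghom_inv.
Qed.

Lemma evalw_eq_iff (G : group) (a : nat -> G) w1 w2 :
  evalw G a w1 = evalw G a w2 <-> evalw G a (w1 ++ winv w2) = gone.
Proof. rewrite evalw_app, evalw_winv. symmetry. apply gmulV_eq1. Qed.

Fixpoint words (n L : nat) : list (list (nat * bool)) :=
  match L with
  | 0 => [[]]
  | S L' => [] :: flat_map (fun w => flat_map (fun i => [(i, true) :: w; (i, false) :: w])
                                              (seq 0 n)) (words n L')
  end.

Lemma in_words n L w : word_in n w -> length w <= L -> In w (words n L).
Proof.
  revert w. induction L as [|L IH]; intros [|[i b] w] h hl; simpl in *; auto; [lia |].
  apply word_in_cons in h as [hi h]. right.
  apply in_flat_map. exists w. split; [apply IH; [easy | lia] |].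
  apply in_flat_map. exists i. split; [apply in_seq; lia |].
  destruct b; simpl; auto.
Qed.

(** * Spans *)

Definition span (G : group) (n : nat) (a : nat -> G) (g : G) : Prop :=
  exists w, word_in n w /\ evalw G a w = g.

Lemma span_subgroup (G : group) n (a : nat -> G) : is_subgroup G (span G n a).
Proof.
  split; [| split].
  - exists []. split; [apply word_in_nil | easy].
  - intros x y [v [hv <-]] [w [hw <-]]. exists (v ++ w).
    split; [now apply word_in_app | apply evalw_app].
  - intros x [w [hw <-]]. exists (winv w).
    split; [now apply word_in_winv | apply evalw_winv].
Qed.

Lemma span_gen (G : group) n (a : nat -> G) i : i < n -> span G n a (a i).
Proof.
  intro hi. exists [(i, false)]. split; [| simpl; now gsimpl].
  apply word_in_cons. split; [easy | apply word_in_nil].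
Qed.

Lemma span_min (G : group) (P : G -> Prop) n (a : nat -> G) (g : G) :
  is_subgroup G P -> (forall i, i < n -> P (a i)) -> span G n a g -> P g.
Proof.
  intros [P1 [PM PV]] ha [w [hw <-]]. revert hw.
  induction w as [|[i b] w IH]; intro h; simpl; [easy |].
  apply word_in_cons in h as [hi h]. apply PM; auto. destruct b; auto.
Qed.

(** * Words and balls *)

(** Two words of length at most [r] have equal values iff a word of length at most [2 * r] is a
    relator; testing an edge costs one more letter. So sending the value of a word in [p] to its
    value in [q] is well defined, injective and compatible with edges. *)
Lemma ball_equiv_of_words n r (p q : mpoint) :
  (forall w, word_in n w -> length w <= 2 * r + 1 ->
     (evalw _ (mp_a p) w = gone <-> evalw _ (mp_a q) w = gone)) ->
  ball_equiv n r p q.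
Proof.
  intro hpq.
  assert (key : forall w1 w2, word_in n w1 -> word_in n w2 ->
    length w1 + length w2 <= 2 * r + 1 ->
    (evalw _ (mp_a p) w1 = evalw _ (mp_a p) w2 <->
     evalw _ (mp_a q) w1 = evalw _ (mp_a q) w2)).
  { intros w1 w2 h1 h2 hl. rewrite !evalw_eq_iff. apply hpq.
    - apply word_in_app; split; auto. now apply word_in_winv.
    - now rewrite length_app, length_winv. }
  assert (ex : forall x, exists y, forall w, word_in n w -> length w <= r ->
            evalw _ (mp_a p) w = x -> evalw _ (mp_a q) w = y).
  { intro x. destruct (classic (in_ball _ n (mp_a p) r x)) as [[v [hv [lv ev]]] | hx].
    - exists (evalw _ (mp_a q) v). intros w hw lw ew. apply key; auto; [lia | congruence].
    (* Arbitrary value outside the ball, so that [phi] is total. *)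
    - exists gone. intros w hw lw ew. destruct hx. now exists w. }
  set (phi := fun x => proj1_sig (constructive_indefinite_description _ (ex x))).
  assert (hphi : forall w, word_in n w -> length w <= r ->
            phi (evalw _ (mp_a p) w) = evalw _ (mp_a q) w).
  { intros w hw lw. unfold phi. symmetry.
    now apply (proj2_sig (constructive_indefinite_description _ (ex (evalw _ (mp_a p) w)))). }
  exists phi. split; [| split; [| split; [| split]]].
  - apply (hphi []); [apply word_in_nil | simpl; lia].
  - intros x [w [hw [lw <-]]]. exists w. now rewrite hphi.
  - intros x y [v [hv [lv <-]]] [w [hw [lw <-]]]. rewrite !hphi by easy.
    apply key; auto; lia.
  - intros y [w [hw [lw <-]]]. exists (evalw _ (mp_a p) w). split; [now exists w | auto].
  - intros x y i [v [hv [lv <-]]] [w [hw [lw <-]]] hi. rewrite !hphi by easy.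
    assert (E : forall s : mpoint, gmul (evalw _ (mp_a s) v) (mp_a s i)
                = evalw _ (mp_a s) (v ++ [(i, false)])).
    { intro s. rewrite evalw_app. simpl. now gsimpl. }
    rewrite !E. apply key; auto.
    + apply word_in_app; split; auto.
      apply word_in_cons. split; [easy | apply word_in_nil].
    + rewrite length_app. simpl. lia.
Qed.

Lemma bounded_lengths (v : nat -> list (nat * bool)) n :
  exists M, forall i, i < n -> length (v i) <= M.
Proof.
  induction n as [|n [M hM]]; [exists 0; lia |].
  exists (M + length (v n)). intros i hi.
  destruct (Nat.eq_dec i n) as [-> | ne]; [lia |].
  specialize (hM i ltac:(lia)). lia.
Qed.

(** * A criterion for being condensed *)

Definition agree_upto (G : group) (n L : nat) (c c' : nat -> G) : Prop :=
  forall w, word_in n w -> length w <= L -> (evalw G c w = gone <-> evalw G c' w = gone).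

(* A single non-isolated marking [c] suffices: express another marking through
   words in [c] and evaluate the same words at the nearby markings [c'].  That these
   still generate is witnessed by finitely many relations, so it holds once [L] is large. *)
Lemma condensed_of_approx (G : group) n (c : nat -> G) :
  generates G n c ->
  (forall L, exists c', generates G n c' /\ agree_upto G n L c c' /\
     exists w, word_in n w /\ ~ (evalw G c w = gone <-> evalw G c' w = gone)) ->
  condensed G.
Proof.
  intros gc approx. split; [now exists n, c |].
  intros p [n0 [pn0 gp]] [f [hf [finv [fK finvK]]]] [U [[_ Uopen] [Up iso]]].
  destruct (Uopen n0 p (conj pn0 gp) Up) as [r hr].
  (* Indices from [n0] on get the empty word, so that the new tuple [a'] is trivial there, as
     [in_Gn] demands. *)
  assert (exv : forall i, exists v, word_in n v /\ evalw G c v = f (mp_a p i)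
            /\ (n0 <= i -> v = [])).
  { intro i. destruct (le_lt_dec n0 i) as [hi | hi].
    - exists []. split; [apply word_in_nil | split; [| easy]].
      rewrite pn0 by easy. symmetry. now apply ghom_one.
    - destruct (gc (f (mp_a p i))) as [v [hv ev]]. exists v. split; [easy | split; [easy | lia]]. }
  set (v := fun i => proj1_sig (constructive_indefinite_description _ (exv i))).
  assert (hv : forall i, word_in n (v i) /\ evalw G c (v i) = f (mp_a p i)
            /\ (n0 <= i -> v i = [])).
  { intro i. apply (proj2_sig (constructive_indefinite_description _ (exv i))). }
  assert (exu : forall j, exists u, word_in n0 u /\ evalw _ (mp_a p) u = finv (c j)).
  { intro j. apply gp. }
  set (u := fun j => proj1_sig (constructive_indefinite_description _ (exu j))).
  assert (hu : forall j, word_in n0 (u j) /\ evalw _ (mp_a p) (u j) = finv (c j)).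
  { intro j. apply (proj2_sig (constructive_indefinite_description _ (exu j))). }
  clearbody u v. clear exu exv.
  destruct (bounded_lengths v n0) as [M hM].
  destruct (bounded_lengths u n) as [M' hM'].
  (* The first summand covers the relators tested for radius [r], rewritten through [v]; the others
     cover [wsubst v (u j)] followed by one inverse letter, the relation by which [a'] recovers
     [c' j]. *)
  destruct (approx (M * (2 * r + 1) + M * M' + 1)) as [c' [gc' [agr [w0 [hw0 diff]]]]].
  assert (ec : forall w, evalw G c (wsubst v w) = f (evalw _ (mp_a p) w)).
  { intro w. rewrite evalw_wsubst, (evalw_hom _ _ f) by easy.
    f_equal. apply functional_extensionality. intro i. apply hv. }
  assert (fone : forall x, f x = gone <-> x = gone).
  { intro x. now apply (ghom_eq_one _ _ f finv). }
  set (a' := fun i => evalw G c' (v i)).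
  assert (ecu : forall j, j < n -> evalw G a' (u j) = c' j).
  { intros j hj. destruct (hu j) as [wu eu].
    assert (R : evalw G c (wsubst v (u j) ++ [(j, true)]) = gone).
    { rewrite evalw_app, ec, eu, finvK. simpl. now gsimpl. }
    apply agr in R.
    - rewrite evalw_app, evalw_wsubst in R. simpl in R.
      rewrite gmul1r in R. exact (proj1 (gmulV_eq1 _ _ _) R).
    - apply word_in_app. split; [apply (word_in_wsubst n0); auto; intros; apply hv |].
      apply word_in_cons. split; [easy | apply word_in_nil].
    - rewrite length_app. pose proof (length_wsubst n0 M v (u j) hM wu) as l1.
      specialize (hM' j hj). simpl. nia. }
  set (q := MPoint G a').
  assert (inq : in_Gn n0 q).
  { split.
    - intros i hi. simpl. unfold a'. destruct (hv i) as [_ [_ ->]]; easy.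
    - intro g. destruct (gc' g) as [w [hw <-]]. exists (wsubst u w). split.
      + apply (word_in_wsubst n); auto. intros; apply hu.
      + simpl. rewrite evalw_wsubst. now apply (evalw_ext _ n). }
  assert (Uq : U q).
  { apply hr; auto. apply ball_equiv_of_words. intros w hw lw. simpl. unfold a'.
    rewrite <- evalw_wsubst, <- fone, <- ec. symmetry. apply agr.
    - apply (word_in_wsubst n0); auto. intros; apply hv.
    - pose proof (length_wsubst n0 M v w hM hw). nia. }
  assert (self : giso (mp_G q) G).
  { exists (fun x => x). split; [now intros x y | now exists (fun x => x)]. }
  destruct (iso q (ex_intro _ n0 inq) self Uq) as [g [[hg [ginv' [gK _]]] ga]].
  (* The isomorphism [g] makes [wsubst u w0] trivial at both [a'] and [p] or at neither, so [w0]
     cannot tell [c] from [c']. *)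
  apply diff.
  assert (e1 : evalw G c' w0 = evalw G a' (wsubst u w0)).
  { rewrite evalw_wsubst. symmetry. now apply (evalw_ext _ n). }
  assert (e2 : evalw G c w0 = f (evalw _ (mp_a p) (wsubst u w0))).
  { rewrite (evalw_hom _ _ f), evalw_wsubst by easy.
    apply (evalw_ext _ n); auto. intros j hj. destruct (hu j) as [_ eu].
    rewrite <- (evalw_hom _ _ f), eu; auto. }
  assert (e3 : g (evalw G a' (wsubst u w0)) = evalw _ (mp_a p) (wsubst u w0)).
  { rewrite (evalw_hom _ _ g) by easy. f_equal.
    apply functional_extensionality. exact ga. }
  rewrite e1, e2, fone, <- e3. now apply (ghom_eq_one _ _ g ginv').
Qed.

(** Relators of a tuple in a subgroup can be computed in the ambient group, and the mutual span
    conditions make every [c'] generate the same subgroup as [c]. *)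
Lemma condensed_span_of_approx (W : group) n (c : nat -> W) :
  (forall i, span W n c (c i)) ->
  (forall L, exists c', (forall i, span W n c (c' i)) /\ (forall i, span W n c' (c i)) /\
     agree_upto W n L c c' /\
     exists w, word_in n w /\ ~ (evalw W c w = gone <-> evalw W c' w = gone)) ->
  condensed (subgroup W (span W n c) (span_subgroup W n c)).
Proof.
  intros hc approx.
  set (S := subgroup W (span W n c) (span_subgroup W n c)).
  set (lift := fun (d : nat -> W) (hd : forall i, span W n c (d i)) i =>
                 exist _ (d i) (hd i) : S).
  assert (ev : forall d hd w, proj1_sig (evalw S (lift d hd) w) = evalw W d w).
  { intros d hd w. apply (evalw_hom S W (fun s => proj1_sig s)). now intros x y. }
  assert (ev1 : forall d hd w, evalw S (lift d hd) w = gone <-> evalw W d w = gone).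
  { intros d hd w. rewrite <- (ev d hd). split; [now intros -> |].
    intro E. now apply sub_eq. }
  assert (gen : forall d hd, (forall i, span W n d (c i)) -> generates S n (lift d hd)).
  { intros d hd cd [x px].
    destruct (span_min W (span W n d) n c x) as [w [hw ew]]; auto.
    { apply span_subgroup. }
    exists w. split; [easy |]. apply sub_eq. now rewrite ev. }
  apply (condensed_of_approx _ n (lift c hc)); [now apply gen |].
  intro L. destruct (approx L) as [c' [hc' [cc' [agr [w [hw diff]]]]]].
  exists (lift c' hc'). split; [now apply gen | split].
  - intros w' hw' lw'. rewrite !ev1. now apply agr.
  - exists w. split; [easy |]. now rewrite !ev1.
Qed.

(** * Integer powers *)

Fixpoint gpow (G : group) (x : G) (n : nat) : G :=
  match n with 0 => gone | S n' => gmul x (gpow G x n') end.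

Definition zpow (G : group) (x : G) (z : Z) : G :=
  gmul (gpow G x (Z.to_nat z)) (ginv (gpow G x (Z.to_nat (- z)))).

Lemma gpow_comm (G : group) (x : G) n : gmul (gpow G x n) x = gmul x (gpow G x n).
Proof. induction n as [|n IH]; simpl; gsimpl; [easy |]. now rewrite IH. Qed.

Lemma zpow_succ (G : group) (x : G) z : zpow G x (Z.succ z) = gmul x (zpow G x z).
Proof.
  unfold zpow. destruct (Z_lt_le_dec z 0) as [h | h].
  - replace (Z.to_nat (Z.succ z)) with 0 by lia.
    replace (Z.to_nat z) with 0 by lia.
    replace (Z.to_nat (- z)) with (S (Z.to_nat (- Z.succ z))) by lia.
    simpl. rewrite <- gpow_comm. now gsimpl.
  - replace (Z.to_nat (Z.succ z)) with (S (Z.to_nat z)) by lia.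
    replace (Z.to_nat (- Z.succ z)) with 0 by lia.
    replace (Z.to_nat (- z)) with 0 by lia.
    simpl. now gsimpl.
Qed.

Lemma zpow_add (G : group) (x : G) z t :
  zpow G x (z + t) = gmul (zpow G x z) (zpow G x t).
Proof.
  revert z. apply Z.bi_induction.
  - now intros a b ->.
  - simpl. unfold zpow at 2. simpl. now gsimpl.
  - intro z. rewrite Z.add_succ_l, !zpow_succ, <- gmulA.
    split; [now intros -> | apply gmul_cancel_l].
Qed.

Lemma zpow0 (G : group) (x : G) : zpow G x 0 = gone.
Proof. unfold zpow. simpl. now gsimpl. Qed.

Lemma zpow1 (G : group) (x : G) : zpow G x 1 = x.
Proof. unfold zpow. simpl. now gsimpl. Qed.

Lemma zpow_opp (G : group) (x : G) z : zpow G x (- z) = ginv (zpow G x z).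
Proof. apply ginv_eq. now rewrite <- zpow_add, Z.add_opp_diag_r, zpow0. Qed.

Lemma zpow_mul_one (G : group) (x : G) z t :
  zpow G x t = gone -> zpow G x (z * t) = gone.
Proof.
  intro ht. revert z. apply Z.bi_induction.
  - now intros a b ->.
  - apply zpow0.
  - intro z. now rewrite Z.mul_succ_l, zpow_add, ht, gmul1r.
Qed.

(** * A recurrent function with isolated points *)

(** Pointwise on finite sets, [phi] is a limit of its translates by nontrivial elements. *)
Definition recurrent (H : group) (phi : H -> Z) : Prop :=
  forall Q : list H, exists h, h <> gone /\ forall q, In q Q -> phi (gmul h q) = phi q.

(** In the finite window [K s] the function vanishes except possibly at [s], and the window misses
    the identity, where the second base generator is supported. *)
Definition isolating (H : group) (phi : H -> Z) : Prop :=
  forall K : list H, exists s, phi s = 1%Z /\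
    forall k, In k K -> gmul k s <> gone /\ (k <> gone -> phi (gmul k s) = 0%Z).

Lemma isolating_translate (H : group) (phi : H -> Z) (h : H) :
  isolating H phi -> isolating H (fun z => phi (gmul h z)).
Proof.
  intros iso K.
  (* The witness will be [h^-1 s]: the points [k h^-1 s] must miss the identity, and the translated
     function reads [phi] at [(h k h^-1) s]. *)
  destruct (iso (map (fun k => gmul k (ginv h)) K ++
                 map (fun k => gmul h (gmul k (ginv h))) K)) as [s [hs hK]].
  exists (gmul (ginv h) s). split; [now gsimpl |].
  intros k hk. split.
  - rewrite gmulA. apply hK, in_app_iff. left. apply in_map_iff. now exists k.
  - intro k1. replace (gmul h _) with (gmul (gmul h (gmul k (ginv h))) s) by now gsimpl.
    apply hK.
    + apply in_app_iff. right. apply in_map_iff. now exists k.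
    + rewrite gmulA, gmulV_eq1. intro E. apply k1, (gmul_cancel_l _ h). now rewrite gmul1r.
Qed.

(* [N] is the finite region on which membership is already decided, [A] the set of its members. *)
Lemma approximation_step (H : group) (K N A : list H) :
  ~ finite_group H -> incl A N ->
  exists N' A', incl A' N' /\ incl N N' /\ incl K N' /\
    (forall z, In z N -> (In z A' <-> In z A)) /\
    (exists h, h <> gone /\ forall q, In q K ->
       In (gmul h q) N' /\ (In (gmul h q) A' <-> In q A')) /\
    (exists s, In s A' /\ forall k, In k K -> gmul k s <> gone /\
       In (gmul k s) N' /\ (k <> gone -> ~ In (gmul k s) A')).
Proof.
  intros inf AN.
  assert (fresh : forall l : list H, exists x, ~ In x l).
  { intro l. apply not_all_ex_not. intro h. apply inf. now exists l. }
  set (N1 := K ++ N).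
  (* Being outside [N1 N1^-1], [h] moves [N1] off itself, so a copy of [A] can be placed in [h N1]
     without conflict. The identity is listed separately in case [N1] is empty. *)
  destruct (fresh (gone :: flat_map (fun u => map (fun v => gmul u (ginv v)) N1) N1)) as [h hh].
  assert (h1 : h <> gone) by (intros ->; apply hh; now left).
  assert (hN1 : forall v, In v N1 -> ~ In (gmul h v) N1).
  { intros v hv hhv. apply hh. right. apply in_flat_map. exists (gmul h v). split; [easy |].
    apply in_map_iff. exists v. split; [now gsimpl | easy]. }
  set (N2 := N1 ++ map (gmul h) N1).
  set (A2 := A ++ map (gmul h) A).
  assert (AN1 : incl A N1) by (intros z hz; apply in_app_iff; auto).
  assert (AN2 : incl A2 N2).
  { intros z hz. apply in_app_iff in hz as [hz | hz]; apply in_app_iff; [left; auto | right].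
    apply in_map_iff in hz as [t [<- ht]]. apply in_map. auto. }
  (* The new isolated member [s] is taken so far out that [K s] meets neither [N2] nor the
     identity. *)
  destruct (fresh (N2 ++ flat_map (fun k => map (gmul (ginv k)) (gone :: N2)) K)) as [s hs].
  assert (sN2 : ~ In s N2) by (intro F; apply hs, in_app_iff; auto).
  assert (ksN2 : forall k, In k K -> ~ In (gmul k s) (gone :: N2)).
  { intros k hk F. apply hs, in_app_iff. right. apply in_flat_map. exists k. split; [easy |].
    apply in_map_iff. exists (gmul k s). split; [now gsimpl | easy]. }
  exists (s :: N2 ++ map (fun k => gmul k s) K), (s :: A2).
  split; [| split; [| split; [| split; [| split]]]].
  - intros z [<- | hz]; [now left | right; apply in_app_iff; auto].
  - intros z hz. right. apply in_app_iff. left. apply in_app_iff. left. apply in_app_iff. auto.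
  - intros z hz. right. apply in_app_iff. left. apply in_app_iff. left. apply in_app_iff. auto.
  - intros z hz. assert (zN1 : In z N1) by (apply in_app_iff; auto). split.
    + intros [<- | F].
      * destruct sN2. apply in_app_iff. auto.
      * apply in_app_iff in F as [F | F]; [easy |].
        apply in_map_iff in F as [t [<- ht]]. destruct (hN1 t); auto.
    + intro F. right. apply in_app_iff. auto.
  - exists h. split; [easy |]. intros q hq.
    assert (qN1 : In q N1) by (apply in_app_iff; auto).
    assert (hqN2 : In (gmul h q) N2) by (apply in_app_iff; right; now apply in_map).
    split; [right; apply in_app_iff; auto |].
    split; (intros [E | F]; [destruct sN2 |]).
    + now rewrite E.
    + right. apply in_app_iff in F as [F | F].
      * destruct (hN1 q qN1). auto.
      * apply in_map_iff in F as [t [E ht]]. apply gmul_cancel_l in E as ->.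
        apply in_app_iff. auto.
    + rewrite E. apply in_app_iff. auto.
    + right. apply in_app_iff in F as [F | F].
      * apply in_app_iff. right. now apply in_map.
      * apply in_map_iff in F as [t [<- ht]]. destruct (hN1 t); auto.
  - exists s. split; [now left |]. intros k hk. specialize (ksN2 k hk).
    split; [intro E; apply ksN2; now left |].
    split; [right; apply in_app_iff; right; apply in_map_iff; now exists k |].
    intros k1 [E | F].
    + apply k1, (gmul_cancel_r _ s). now rewrite gmul1l.
    + apply ksN2. right. auto.
Qed.

(** The step is iterated along the word balls [E i], which exhaust [H]. Membership decided at one
    stage is never revised, so the union of the stages keeps the translate and the isolated point
    obtained at each of them. *)
Lemma exists_recurrent_isolating (H : group) :
  fin_gen H -> ~ finite_group H -> exists phi, recurrent H phi /\ isolating H phi.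
Proof.
  intros [m [a ga]] inf.
  set (E := fun i => map (evalw H a) (words m i)).
  assert (exh : forall l : list H, exists i0, forall i, i0 <= i -> incl l (E i)).
  { induction l as [|x l [i0 IH]]; [exists 0; intros i _ z [] |].
    destruct (ga x) as [w [hw ew]]. exists (i0 + length w). intros i hi z [<- | hz].
    - apply in_map_iff. exists w. split; [easy |]. apply in_words; [easy | lia].
    - apply (IH i); [lia | easy]. }
  (* The invariant sits inside the existential so that choice yields a total function [nxt]; states
     violating it get a default value. *)
  assert (step : forall i (s : list H * list H), exists s', incl (snd s) (fst s) ->
    incl (snd s') (fst s') /\ incl (fst s) (fst s') /\ incl (E i) (fst s') /\
    (forall z, In z (fst s) -> (In z (snd s') <-> In z (snd s))) /\
    (exists h, h <> gone /\ forall q, In q (E i) ->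
       In (gmul h q) (fst s') /\ (In (gmul h q) (snd s') <-> In q (snd s'))) /\
    (exists t, In t (snd s') /\ forall k, In k (E i) -> gmul k t <> gone /\
       In (gmul k t) (fst s') /\ (k <> gone -> ~ In (gmul k t) (snd s')))).
  { intros i [N A]. destruct (classic (incl A N)) as [AN | nAN].
    - destruct (approximation_step H (E i) N A inf AN) as [N' [A' hs]].
      exists (N', A'). intros _. exact hs.
    - exists ([], []). intro F. now destruct nAN. }
  set (nxt := fun i s => proj1_sig (constructive_indefinite_description _ (step i s))).
  assert (hnxt := fun i s => proj2_sig (constructive_indefinite_description _ (step i s))).
  fold nxt in hnxt. cbv beta in hnxt.
  set (st := fix st i := match i with 0 => ([], []) | S i' => nxt i' (st i') end).
  assert (inv : forall i, incl (snd (st i)) (fst (st i))).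
  { induction i as [|i IH]; [easy |]. now apply (hnxt i (st i)). }
  assert (hst := fun i => hnxt i (st i) (inv i)).
  change (fun i => nxt i (st i)) with (fun i => st (S i)) in hst.
  assert (mono : forall i j, i <= j -> incl (fst (st i)) (fst (st j)) /\
            forall z, In z (fst (st i)) -> (In z (snd (st j)) <-> In z (snd (st i)))).
  { intros i j ij. induction ij as [|j ij [I1 I2]]; [split; [apply incl_refl | easy] |].
    destruct (hst j) as [_ [J1 [_ [J2 _]]]]. split.
    - eapply incl_tran; [exact I1 | exact J1].
    - intros z hz. rewrite <- I2 by easy. apply J2. auto. }
  set (S0 := fun z => exists i, In z (snd (st i))).
  assert (hS : forall i z, In z (fst (st i)) -> (S0 z <-> In z (snd (st i)))).
  { intros i z hz. split; [intros [j hj] | now exists i].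
    destruct (le_lt_dec i j) as [ij | ij]; [now apply (mono i j ij) |].
    apply (mono j i); [lia | now apply inv | easy]. }
  exists (fun z => if excluded_middle_informative (S0 z) then 1%Z else 0%Z). split.
  - intro Q. destruct (exh Q) as [i hQ]. specialize (hQ i (le_n i)).
    destruct (hst i) as [_ [_ [J1 [_ [[h [h1 hh]] _]]]]].
    exists h. split; [easy |]. intros q hq. apply hQ in hq.
    destruct (hh q hq) as [hN hA].
    assert (eqv : S0 (gmul h q) <-> S0 q).
    { rewrite (hS (S i)) by exact hN. rewrite (hS (S i) q) by (apply J1; easy). exact hA. }
    do 2 destruct excluded_middle_informative; tauto.
  - intro K. destruct (exh K) as [i hK]. specialize (hK i (le_n i)).
    destruct (hst i) as [I [_ [_ [_ [_ [s [sA hs]]]]]]].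
    exists s. split.
    + destruct excluded_middle_informative as [_ | F]; [easy |].
      destruct F. now exists (S i).
    + intros k hk. apply hK in hk. destruct (hs k hk) as [k1 [kN kA]].
      split; [easy |]. intro kn1.
      destruct excluded_middle_informative as [F | _]; [| easy].
      apply (hS (S i)) in F; [| exact kN]. now destruct (kA kn1).
Qed.

(** * The marked subgroups *)

Section Marking.
Variables (B H : group) (x y : B) (m : nat) (a : nat -> H).
Hypothesis a_trivial : forall i, m <= i -> a i = gone.

(** Indices below [m] are kept for the generators of [H]; index [m] gives f and [S m] gives g.
    Integer values of [phi] let exponents be additive in it. *)
Definition base (phi : H -> Z) (i : nat) : H -> B :=
  if i =? m then fun z => zpow B x (phi z)
  else if i =? S m then fun z => if excluded_middle_informative (z = gone) then y else gone
  else fun _ => gone.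

Definition marking (phi : H -> Z) (i : nat) : wreath B H := (base phi i, a i).

Definition letter (i : nat) (b : bool) : H := if b then ginv (a i) else a i.

(* Evaluating a word at [z] reads the base functions at the points [q z], for [q] in this list. *)
Fixpoint visit (w : list (nat * bool)) : list H :=
  match w with
  | [] => []
  | (i, b) :: w' => gone :: map (fun q => gmul q (ginv (letter i b))) (visit w')
  end.

(** The total exponent of [x] collected at a point [z], with [psi q] standing for [phi (q z)]; as a
    function of [psi] it is a linear form given by an element of the integral group ring of [H]. *)
Fixpoint exponent (w : list (nat * bool)) (psi : H -> Z) : Z :=
  match w with
  | [] => 0
  | (i, b) :: w' => (if (i =? m)%nat then if b then - psi gone else psi gone else 0) +
                    exponent w' (fun q => psi (gmul q (ginv (letter i b))))
  end%Z.

Lemma snd_evalw_marking phi w : snd (evalw _ (marking phi) w) = evalw H a w.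
Proof. apply (evalw_hom (wreath B H) H snd). now intros u v. Qed.

(** An inverse letter reads its base function at [a i * z] instead of [z]; this changes nothing,
    since [a i] or the base function is trivial. *)
Lemma fst_evalw_marking_cons phi i b w z :
  fst (evalw _ (marking phi) ((i, b) :: w)) z =
  gmul (if b then ginv (base phi i z) else base phi i z)
       (fst (evalw _ (marking phi) w) (gmul (ginv (letter i b)) z)).
Proof.
  destruct b; simpl; [| easy]. f_equal. f_equal.
  destruct (le_lt_dec m i) as [hi | hi]; [now rewrite a_trivial, gmul1l by easy |].
  unfold base. replace (i =? m) with false by (symmetry; apply Nat.eqb_neq; lia).
  now replace (i =? S m) with false by (symmetry; apply Nat.eqb_neq; lia).
Qed.

Lemma evalw_marking_ext phi phi' w z :
  (forall q, In q (visit w) -> phi (gmul q z) = phi' (gmul q z)) ->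
  fst (evalw _ (marking phi) w) z = fst (evalw _ (marking phi') w) z.
Proof.
  revert z. induction w as [|[i b] w IH]; intros z h; [easy |].
  rewrite !fst_evalw_marking_cons.
  assert (hz : base phi i z = base phi' i z).
  { unfold base. destruct (i =? m); [| easy].
    specialize (h gone (or_introl eq_refl)). rewrite gmul1l in h. now rewrite h. }
  rewrite hz. f_equal. apply IH. intros q hq. rewrite !gmulA. apply h. right.
  apply in_map_iff. now exists q.
Qed.

Lemma exponent_ext w psi psi' :
  (forall q, In q (visit w) -> psi q = psi' q) -> exponent w psi = exponent w psi'.
Proof.
  revert psi psi'. induction w as [|[i b] w IH]; intros psi psi' h; [easy |]. simpl.
  rewrite (h gone) by now left. f_equal. apply IH. intros q hq. apply h. right.
  apply in_map_iff. now exists q.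
Qed.

Lemma exponent_add w psi psi' :
  exponent w (fun q => psi q + psi' q)%Z = (exponent w psi + exponent w psi')%Z.
Proof.
  revert psi psi'. induction w as [|[i b] w IH]; intros psi psi'; [easy |]. simpl.
  rewrite IH. destruct (i =? m), b; lia.
Qed.

Lemma exponent_scale w t psi :
  exponent w (fun q => t * psi q)%Z = (t * exponent w psi)%Z.
Proof.
  revert psi. induction w as [|[i b] w IH]; intros psi; simpl; [lia |].
  rewrite IH. destruct (i =? m), b; lia.
Qed.

Lemma evalw_marking_exponent phi w z :
  (forall q, In q (visit w) -> gmul q z <> gone) ->
  fst (evalw _ (marking phi) w) z = zpow B x (exponent w (fun q => phi (gmul q z))).
Proof.
  revert z. induction w as [|[i b] w IH]; intros z h; [now rewrite zpow0 |].
  rewrite fst_evalw_marking_cons. simpl. rewrite zpow_add. f_equal.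
  - assert (z1 : z <> gone).
    { rewrite <- (gmul1l _ z). apply h. now left. }
    rewrite gmul1l. unfold base. destruct (i =? m).
    + destruct b; [now rewrite zpow_opp | easy].
    + rewrite zpow0. destruct (i =? S m).
      * destruct excluded_middle_informative; [easy |]. destruct b; now gsimpl.
      * destruct b; now gsimpl.
  - rewrite IH.
    + f_equal. f_equal. apply functional_extensionality. intro q. now rewrite gmulA.
    + intros q hq. rewrite gmulA. apply h. right. apply in_map_iff. now exists q.
Qed.

Definition delta (p q : H) : Z := if excluded_middle_informative (q = p) then 1%Z else 0%Z.

(** Only the values of [psi] on the finite list [visit w] count, so [psi] may be replaced by an
    integer combination of point masses, and the exponent is linear. *)
Lemma zpow_exponent_one w psi :
  (forall p, zpow B x (exponent w (delta p)) = gone) ->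
  zpow B x (exponent w psi) = gone.
Proof.
  intro hd.
  assert (fin : forall l : list H, zpow B x (exponent w (fun q =>
            if excluded_middle_informative (In q l) then psi q else 0%Z)) = gone).
  { induction l as [|p l IH].
    - rewrite (exponent_ext _ _ (fun q => 0 * delta gone q)%Z).
      + now rewrite exponent_scale, zpow0.
      + intros q _. destruct excluded_middle_informative as [[] | _]. easy.
    - destruct (classic (In p l)) as [hp | hp].
      + rewrite <- IH. f_equal. apply exponent_ext. intros q _.
        do 2 destruct excluded_middle_informative; simpl in *; try easy; [| tauto].
        destruct i as [-> | i]; tauto.
      + rewrite (exponent_ext _ _ (fun q => psi p * delta p q +
          if excluded_middle_informative (In q l) then psi q else 0)%Z).
        * rewrite exponent_add, exponent_scale, zpow_add, IH, gmul1r.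
          apply zpow_mul_one, hd.
        * intros q _. unfold delta.
          do 3 destruct excluded_middle_informative; simpl in *; subst; try tauto; try lia.
          all: destruct i as [-> | i]; tauto. }
  rewrite <- (fin (visit w)). f_equal. apply exponent_ext. intros q hq.
  now destruct excluded_middle_informative.
Qed.

(* At points where the word never meets the support of the second base function only powers
   of [x] occur, and the isolated points show that each exponent is killed separately;
   the remaining points lie in a finite set on which [phi] and [phi'] give the same value. *)
Lemma evalw_marking_transfer phi phi' w :
  isolating H phi ->
  (forall q q', In q (visit w) -> In q' (visit w) ->
     phi (gmul q (ginv q')) = phi' (gmul q (ginv q'))) ->
  evalw _ (marking phi) w = gone -> evalw _ (marking phi') w = gone.
Proof.
  intros iso agr E.
  assert (E1 : forall z, fst (evalw _ (marking phi) w) z = gone) by now rewrite E.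
  assert (E2 : snd (evalw _ (marking phi') w) = gone).
  { rewrite snd_evalw_marking, <- (snd_evalw_marking phi). now rewrite E. }
  assert (E1' : forall z, fst (evalw _ (marking phi') w) z = gone).
  { intro z. destruct (classic (exists q', In q' (visit w) /\ gmul q' z = gone))
      as [[q' [hq' ez]] | far].
    - rewrite <- (E1 z). symmetry. apply evalw_marking_ext. intros q hq.
      rewrite (ginv_eq _ _ _ ez). now apply agr.
    - rewrite evalw_marking_exponent by (intros q hq F; apply far; now exists q).
      apply zpow_exponent_one. intro p.
      (* Read from the point [p^-1 s] along [visit w], [phi] is exactly the point mass at [p]. *)
      destruct (iso (map (fun q => gmul q (ginv p)) (visit w))) as [s [s1 hs]].
      assert (hs' : forall q, In q (visit w) -> gmul q (gmul (ginv p) s) <> gone /\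
                (q <> p -> phi (gmul q (gmul (ginv p) s)) = 0%Z)).
      { intros q hq. rewrite gmulA, <- (gmulV_eq1 _ q p). apply hs. apply in_map_iff. now exists q. }
      rewrite <- (E1 (gmul (ginv p) s)), evalw_marking_exponent by (intros q hq; now apply hs').
      f_equal. apply exponent_ext. intros q hq. unfold delta.
      destruct excluded_middle_informative as [-> | ne].
      + now rewrite gmulVK, s1.
      + symmetry. now apply hs'. }
  destruct (evalw _ (marking phi') w) as [u k]. simpl in *. subst k.
  unfold wr_one. f_equal. apply functional_extensionality. exact E1'.
Qed.

Lemma evalw_marking_top phi w :
  word_in m w -> evalw _ (marking phi) w = ((fun _ => gone), evalw H a w) :> wreath B H.
Proof.
  intro h. rewrite <- (snd_evalw_marking phi).
  assert (F : fst (evalw _ (marking phi) w) = (fun _ => gone)).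
  { revert h. induction w as [|[i b] w IH]; intro h; [easy |].
    apply word_in_cons in h as [hi h]. apply functional_extensionality. intro z.
    rewrite fst_evalw_marking_cons, IH by easy. unfold base.
    replace (i =? m) with false by (symmetry; apply Nat.eqb_neq; lia).
    replace (i =? S m) with false by (symmetry; apply Nat.eqb_neq; lia).
    destruct b; now gsimpl. }
  rewrite <- F. apply surjective_pairing.
Qed.

(** * Translated markings and their separation *)

Hypothesis a_generates : generates H m a.

Lemma conj_marking phi (h : H) :
  gmul (((fun _ => gone), ginv h) : wreath B H)
    (gmul (marking phi m) (((fun _ => gone), h) : wreath B H))
  = marking (fun z => phi (gmul h z)) m.
Proof.
  unfold marking, base. rewrite Nat.eqb_refl, a_trivial by easy. simpl. unfold wr_mul. simpl.
  gsimpl. f_equal. apply functional_extensionality. intro z. now gsimpl.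
Qed.

Lemma span_marking phi i : span _ (S (S m)) (marking phi) (marking phi i).
Proof.
  destruct (le_lt_dec (S (S m)) i) as [hi | hi]; [| now apply span_gen].
  replace (marking phi i) with (@gone (wreath B H)).
  - apply span_subgroup.
  - unfold marking, base. rewrite a_trivial by lia.
    replace (i =? m) with false by (symmetry; apply Nat.eqb_neq; lia).
    now replace (i =? S m) with false by (symmetry; apply Nat.eqb_neq; lia).
Qed.

(** Only the generator with index [m] depends on [phi], and its translate is its conjugate by an
    element of [H], which the first [m] generators span. *)
Lemma span_marking_translate phi (h : H) i :
  span _ (S (S m)) (marking phi) (marking (fun z => phi (gmul h z)) i).
Proof.
  destruct (Nat.eq_dec i m) as [-> | ne].
  - assert (top : forall k : H, span _ (S (S m)) (marking phi) (((fun _ => gone), k) : wreath B H)).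
    { intro k. destruct (a_generates k) as [w [hw <-]]. exists w.
      split; [apply (word_in_le m); [lia | easy] | now apply evalw_marking_top]. }
    rewrite <- conj_marking. destruct (span_subgroup _ (S (S m)) (marking phi)) as [_ [M _]].
    apply M; [apply top | apply M; [apply span_gen; lia | apply top]].
  - replace (marking (fun z => phi (gmul h z)) i) with (marking phi i).
    + apply span_marking.
    + unfold marking, base. now replace (i =? m) with false by (symmetry; now apply Nat.eqb_neq).
Qed.

(* The commutator of the second base generator with a conjugate of the first one by [s^-1]
   evaluates at [1] to the commutator of [x ^ phi s] and [y]. *)
Lemma marking_separating_word phi phi' (s : H) :
  gmul x y <> gmul y x -> phi s = 1%Z -> phi' s = 0%Z ->
  exists w, word_in (S (S m)) w /\
    ~ (evalw _ (marking phi) w = gone <-> evalw _ (marking phi') w = gone).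
Proof.
  intros xy hs hs'. destruct (a_generates s) as [v [hv ev]].
  set (u := winv v ++ [(m, false)] ++ v).
  set (t := [(S m, false)]).
  assert (wt : word_in (S (S m)) t).
  { apply word_in_cons. split; [lia | apply word_in_nil]. }
  assert (wu : word_in (S (S m)) u).
  { apply (word_in_le _ (S (S m))) in hv; [| lia].
    apply word_in_app; split; [now apply word_in_winv |].
    apply word_in_cons. split; [lia | easy]. }
  assert (comm : forall psi, evalw _ (marking psi) ((u ++ t) ++ winv (t ++ u)) = gone <->
            gmul (zpow B x (psi s)) y = gmul y (zpow B x (psi s))).
  { intro psi. rewrite <- evalw_eq_iff, !evalw_app.
    assert (eu : evalw _ (marking psi) u = marking (fun z => psi (gmul s z)) m).
    { unfold u. rewrite !evalw_app, evalw_winv, evalw_marking_top, ev, <- conj_marking by easy.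
      f_equal.
      - simpl. unfold wr_inv. simpl. now gsimpl.
      - f_equal. exact (gmul1r (wreath B H) (marking psi m)). }
    assert (et : evalw _ (marking psi) t = marking psi (S m))
      by exact (gmul1r (wreath B H) _).
    rewrite eu, et. unfold marking, base.
    rewrite Nat.eqb_refl, !a_trivial by lia.
    replace (S m =? m) with false by (symmetry; apply Nat.eqb_neq; lia).
    rewrite Nat.eqb_refl. simpl. unfold wr_mul. simpl. split.
    - intro E. apply (f_equal fst) in E. simpl in E. apply (f_equal (fun F => F gone)) in E.
      revert E. gsimpl. destruct excluded_middle_informative; [| easy]. easy.
    - intro E. f_equal. apply functional_extensionality. intro z. gsimpl.
      destruct excluded_middle_informative as [-> | _]; now gsimpl. }
  exists ((u ++ t) ++ winv (t ++ u)). split.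
  - apply word_in_app. split; [| apply word_in_winv]; now apply word_in_app.
  - rewrite !comm, hs, hs', zpow1, zpow0. gsimpl. intros [_ F]. auto.
Qed.

Lemma condensed_marking phi :
  gmul x y <> gmul y x -> recurrent H phi -> isolating H phi ->
  condensed (subgroup _ _ (span_subgroup _ (S (S m)) (marking phi))).
Proof.
  intros xy rec iso. apply condensed_span_of_approx; [apply span_marking |].
  intro L.
  set (V := flat_map visit (words (S (S m)) L)).
  (* On [V V^-1], [phi] and its translate agree; these are all the values compared when a relator of
     length at most [L] is transferred. *)
  destruct (rec (flat_map (fun q => map (fun q' => gmul q (ginv q')) V) V)) as [h [h1 hV]].
  assert (agr : forall w, word_in (S (S m)) w -> length w <= L ->
            forall q q', In q (visit w) -> In q' (visit w) ->
            phi (gmul h (gmul q (ginv q'))) = phi (gmul q (ginv q'))).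
  { intros w hw lw q q' hq hq'. apply hV. apply in_flat_map. exists q.
    assert (sub : incl (visit w) V).
    { intros z hz. apply in_flat_map. exists w. split; [now apply in_words | easy]. }
    split; [auto |]. apply in_map_iff. exists q'. auto. }
  set (phi' := fun z => phi (gmul h z)).
  exists (marking phi'). split; [| split; [| split]].
  - intro i. apply span_marking_translate.
  - intro i. replace phi with (fun z => phi' (gmul (ginv h) z)).
    + apply span_marking_translate.
    + apply functional_extensionality. intro z. unfold phi'. now gsimpl.
  - intros w hw lw. split; apply evalw_marking_transfer.
    + easy.
    + intros q q' hq hq'. symmetry. now apply (agr w).
    + now apply isolating_translate.
    + intros q q' hq hq'. now apply (agr w).
  (* The point [s] isolated for the window [[h]] has [phi s = 1] but [phi (h s) = 0], because [h] is
     nontrivial. *)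
  - destruct (iso [h]) as [s [hs hs']].
    apply (marking_separating_word phi phi' s xy hs). apply hs'; [now left | easy].
Qed.

End Marking.

Theorem theorem1p2 (B H : group) :
  ~ abelian B -> fin_gen H -> ~ finite_group H ->
  exists (P : wreath B H -> Prop) (hP : is_subgroup (wreath B H) P),
    condensed (subgroup (wreath B H) P hP).
Proof.
  intros nab fg inf.
  assert (xy : exists x y : B, gmul x y <> gmul y x).
  { apply NNPP. intro F. apply nab. intros x y. apply NNPP. intro n. apply F. now exists x, y. }
  destruct xy as [x [y xy]].
  destruct (exists_recurrent_isolating H fg inf) as [phi [rec iso]].
  destruct fg as [m [a0 ga0]].
  (* Padding by the identity frees the indices [m] and [S m] for the two base generators. *)
  set (a := fun i => if i <? m then a0 i else gone).
  assert (a_trivial : forall i, m <= i -> a i = gone).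
  { intros i hi. unfold a. now replace (i <? m) with false by (symmetry; now apply Nat.ltb_ge). }
  assert (ga : generates H m a).
  { intro g. destruct (ga0 g) as [w [hw <-]]. exists w. split; [easy |].
    apply (evalw_ext _ m); [| easy]. intros i hi. unfold a.
    now replace (i <? m) with true by (symmetry; now apply Nat.ltb_lt). }
  exists (span _ (S (S m)) (marking B H x y m a phi)), (span_subgroup _ _ _).
  now apply condensed_marking.
Qed.
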